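(* Let $m,\ell\in\mathbb{R}$, $m\neq 0$, and let $s_1,s_2,S_1,S_2,\varphi_1,\varphi_2,\Phi,\Psi$ be related as follows: $$\Psi(s_1,s_2)=4ms_1s_2-2\ell(s_1+s_2)+\tfrac1m(\ell^2-1),\qquad \Phi(s)=\Psi(s,s)=4ms^2-4\ell s+\tfrac1m(\ell^2-1),$$ $$S_1^2=s_1^2-a^2,\quad S_2^2=b^2-s_2^2,\quad \varphi_1^2=-\Phi(s_1),\quad \varphi_2^2=\Phi(s_2).$$ Consider a solution of the generalized Kowalevski top equations (see context) lying on the second critical subsystem $\mathcal{M}_2$ with $M=m$, $L=\ell$, on a time interval where $x_1x_2\ne0$, and put $$s_1=\frac{x^2+z^2+r^2}{2x},\qquad s_2=\frac{x^2+z^2-r^2}{2x},\qquad x^2=x_1x_2,\quad z^2=z_1z_2 .$$ Then at each moment $s_1,s_2$ are real, $s_1\neq s_2$, $s_1^2\ge a^2$, $s_2^2\le b^2$, $\Phi(s_1)\le 0$, $\Phi(s_2)\ge 0$, and there is a choice of signs of the real radicals $S_1,S_2,\varphi_1,\varphi_2$ such that all phase variables are expressed by (with $\Psi=\Psi(s_1,s_2)$) $$\alpha_1=\frac{(s_1s_2-a^2)\Psi+S_1S_2\varphi_1\varphi_2}{2(s_1-s_2)^2},\qquad \alpha_2=\frac{(s_1s_2-a^2)\varphi_1\varphi_2-S_1S_2\Psi}{2(s_1-s_2)^2},$$ $$\beta_1=-\frac{(s_1s_2-b^2)\varphi_1\varphi_2-S_1S_2\Psi}{2(s_1-s_2)^2},\qquad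 \beta_2=\frac{(s_1s_2-b^2)\Psi+S_1S_2\varphi_1\varphi_2}{2(s_1-s_2)^2},$$ $$\alpha_3=\frac{r\,S_1}{s_1-s_2},\qquad \beta_3=\frac{r\,S_2}{s_1-s_2},$$ $$\omega_1=\frac{r(\ell-2ms_1)\varphi_2}{2(s_1-s_2)},\qquad \omega_2=\frac{r(\ell-2ms_2)\varphi_1}{2(s_1-s_2)},\qquad \omega_3=-\frac{S_2\varphi_1+S_1\varphi_2}{s_1-s_2},$$ and, with these same values of the radicals, the variables separate: $$\frac{ds_1}{dt}=\tfrac12 S_1\varphi_1=\tfrac12\sqrt{s_1^2-a^2}\,\sqrt{-\Phi(s_1)},\qquad \frac{ds_2}{dt}=\tfrac12 S_2\varphi_2=\tfrac12\sqrt{b^2-s_2^2}\,\sqrt{\Phi(s_2)} .$$ The signs of the four radicals are arbitrary: for any real $s_1\ne s_2$ with $s_1^2\ge a^2$, $s_2^2\le b^2$, $\Phi(s_1)\le0$, $\Phi(s_2)\ge0$ and any choice of signs, the formulas above define a point of $\mathcal{M}_2$ with $M=m$, $L=\ell$ (where $L$ is computed with $x=r^2/(s_1-s_2)$).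
   Context: Fix constants $a>b>0$ and put $p^2=a^2+b^2$, $r^2=a^2-b^2$ with $p,r>0$. The phase space $\mathcal{P}\subset\mathbb{R}^9$ is the set of $(\omega,\alpha,\beta)\in\mathbb{R}^3\times\mathbb{R}^3\times\mathbb{R}^3$ with $|\alpha|^2=a^2$, $|\beta|^2=b^2$, $\alpha\cdot\beta=0$. The equations of the generalized Kowalevski top (in two constant fields) on $\mathcal{P}$ are $$2\dot\omega_1=\omega_2\omega_3+\beta_3,\quad 2\dot\omega_2=-\omega_1\omega_3-\alpha_3,\quad \dot\omega_3=\alpha_2-\beta_1,\quad \dot\alpha=\alpha\times\omega,\quad \dot\beta=\beta\times\omega .$$ Complex phase variables ($\mathrm{i}^2=-1$): $$x_1=(\alpha_1-\beta_2)+\mathrm{i}(\alpha_2+\beta_1),\quad x_2=\overline{x_1},\quad y_1=(\alpha_1+\beta_2)+\mathrm{i}(\alpha_2-\beta_1),\quad y_2=\overline{y_1},$$ $$z_1=\alpha_3+\mathrm{i}\beta_3,\quad z_2=\overline{z_1},\quad w_1=\omega_1+\mathrm{i}\omega_2,\quad w_2=\overline{w_1},\quad w_3=\omega_3 .$$ The second critical subsystem $\mathcal{M}_2\subset\mathcal{P}$ is the set (considered where $x_1x_2\neq0$) given by $$x_1x_2w_3-(x_2z_1w_1+x_1z_2w_2)=0,\qquad \frac{x_2}{x_1}(w_1^2+x_1)-\frac{x_1}{x_2}(w_2^2+x_2)=0 .$$ On $\mathcal{M}_2$ one uses the first integrals $$M=\frac1{2r^2}\Bigl[\frac{x_2}{x_1}(w_1^2+x_1)+\frac{x_1}{x_2}(w_2^2+x_2)\Bigr],\qquad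 L=\frac1{x}\bigl(w_1w_2+(x_1x_2+z_1z_2)M\bigr),$$ where $x=\sqrt{x_1x_2}$ is a real nonzero square root of $x_1x_2=|x_1|^2$, chosen continuously along the solution; the same $x$ is used in $L$ and in the definition of $s_1,s_2$. *)

(* Defs.v *)
From Stdlib Require Import Reals.
From Coquelicot Require Import Coquelicot.

Open Scope R_scope.

Record vec3 := Vec3 { v1 : R; v2 : R; v3 : R }.

Definition dot (u v : vec3) : R := v1 u * v1 v + v2 u * v2 v + v3 u * v3 v.

Definition cross (u v : vec3) : vec3 :=
  Vec3 (v2 u * v3 v - v3 u * v2 v)
       (v3 u * v1 v - v1 u * v3 v)
       (v1 u * v2 v - v2 u * v1 v).

Definition is_derive3 (u : R -> vec3) (t : R) (d : vec3) : Prop :=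
  is_derive (fun s => v1 (u s)) t (v1 d) /\
  is_derive (fun s => v2 (u s)) t (v2 d) /\
  is_derive (fun s => v3 (u s)) t (v3 d).

(* A point (omega, alpha, beta) of R^9; membership in the phase space P
   is [in_phase_space]. *)
Record state := State { omega : vec3; alpha : vec3; beta : vec3 }.

Definition in_phase_space (a b : R) (p : state) : Prop :=
  dot (alpha p) (alpha p) = a ^ 2 /\
  dot (beta p) (beta p) = b ^ 2 /\
  dot (alpha p) (beta p) = 0.

(* The equations of motion at time t. *)
Definition kowalevski_eqs (p : R -> state) (t : R) : Prop :=
  is_derive (fun s => 2 * v1 (omega (p s))) t
    (v2 (omega (p t)) * v3 (omega (p t)) + v3 (beta (p t))) /\
  is_derive (fun s => 2 * v2 (omega (p s))) t
    (- v1 (omega (p t)) * v3 (omega (p t)) - v3 (alpha (p t))) /\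
  is_derive (fun s => v3 (omega (p s))) t
    (v2 (alpha (p t)) - v1 (beta (p t))) /\
  is_derive3 (fun s => alpha (p s)) t (cross (alpha (p t)) (omega (p t))) /\
  is_derive3 (fun s => beta (p s)) t (cross (beta (p t)) (omega (p t))).

(* Complex phase variables; a pair (u, v) : C stands for u + i v.
   y1, y2 are not needed for the second critical subsystem. *)
Definition x1 (p : state) : C :=
  (v1 (alpha p) - v2 (beta p), v2 (alpha p) + v1 (beta p)).
Definition x2 (p : state) : C := Cconj (x1 p).
Definition z1 (p : state) : C := (v3 (alpha p), v3 (beta p)).
Definition z2 (p : state) : C := Cconj (z1 p).
Definition w1 (p : state) : C := (v1 (omega p), v2 (omega p)).
Definition w2 (p : state) : C := Cconj (w1 p).
Definition w3 (p : state) : C := RtoC (v3 (omega p)).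

Definition in_M2 (a b : R) (p : state) : Prop :=
  in_phase_space a b p /\
  (x1 p * x2 p)%C <> RtoC 0 /\
  (x1 p * x2 p * w3 p - (x2 p * z1 p * w1 p + x1 p * z2 p * w2 p))%C
    = RtoC 0 /\
  (x2 p / x1 p * (w1 p ^ 2 + x1 p) - x1 p / x2 p * (w2 p ^ 2 + x2 p))%C
    = RtoC 0.

(* The first integrals, as the complex expressions they are given by. *)
Definition M_int (r : R) (p : state) : C :=
  (RtoC 1 / (RtoC 2 * RtoC r ^ 2) *
   (x2 p / x1 p * (w1 p ^ 2 + x1 p) + x1 p / x2 p * (w2 p ^ 2 + x2 p)))%C.

(* [x] is the chosen real square root of x1 x2. *)
Definition L_int (r x : R) (p : state) : C :=
  (RtoC 1 / RtoC x *
   (w1 p * w2 p + (x1 p * x2 p + z1 p * z2 p) * M_int r p))%C.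

Definition is_root_x (x : R) (p : state) : Prop :=
  x <> 0 /\ (RtoC x ^ 2 = x1 p * x2 p)%C.

(* The separation variables, with x^2 = x1 x2 and z^2 = z1 z2. *)
Definition s1_expr (r x : R) (p : state) : C :=
  ((RtoC x ^ 2 + z1 p * z2 p + RtoC r ^ 2) / (RtoC 2 * RtoC x))%C.
Definition s2_expr (r x : R) (p : state) : C :=
  ((RtoC x ^ 2 + z1 p * z2 p - RtoC r ^ 2) / (RtoC 2 * RtoC x))%C.

Definition Psi (m l s1 s2 : R) : R :=
  4 * m * s1 * s2 - 2 * l * (s1 + s2) + 1 / m * (l ^ 2 - 1).

Definition Phi (m l s : R) : R := Psi m l s s.

(* The domain of the separation variables. *)
Definition admissible (a b m l s1 s2 : R) : Prop :=
  s1 <> s2 /\ s1 ^ 2 >= a ^ 2 /\ s2 ^ 2 <= b ^ 2 /\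
  Phi m l s1 <= 0 /\ Phi m l s2 >= 0.

(* S1, S2, f1, f2 (for phi_1, phi_2) are radicals with arbitrary signs. *)
Definition radicals (a b m l s1 s2 S1 S2 f1 f2 : R) : Prop :=
  S1 ^ 2 = s1 ^ 2 - a ^ 2 /\ S2 ^ 2 = b ^ 2 - s2 ^ 2 /\
  f1 ^ 2 = - Phi m l s1 /\ f2 ^ 2 = Phi m l s2.

Definition separated_state (a b r m l s1 s2 S1 S2 f1 f2 : R) : state :=
  let P := Psi m l s1 s2 in
  {| omega := Vec3
       (r * (l - 2 * m * s1) * f2 / (2 * (s1 - s2)))
       (r * (l - 2 * m * s2) * f1 / (2 * (s1 - s2)))
       (- ((S2 * f1 + S1 * f2) / (s1 - s2)));
     alpha := Vec3
       (((s1 * s2 - a ^ 2) * P + S1 * S2 * f1 * f2) / (2 * (s1 - s2) ^ 2))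
       (((s1 * s2 - a ^ 2) * f1 * f2 - S1 * S2 * P) / (2 * (s1 - s2) ^ 2))
       (r * S1 / (s1 - s2));
     beta := Vec3
       (- (((s1 * s2 - b ^ 2) * f1 * f2 - S1 * S2 * P) / (2 * (s1 - s2) ^ 2)))
       (((s1 * s2 - b ^ 2) * P + S1 * S2 * f1 * f2) / (2 * (s1 - s2) ^ 2))
       (r * S2 / (s1 - s2)) |}.

(* Main.v *)
Require Import Defs.
From Stdlib Require Import Reals Lra.
From Coquelicot Require Import Coquelicot.

Open Scope R_scope.

(** On [M_2] with [M = m], both [(x2/x1)(w1^2 + x1)] and its conjugate equal
[r^2 m].  For [W = u + i v = x2 w1 / x] this says [W^2 = r^2 m - x2], while
[L = l] gives [|W|^2 = l x - (x^2 + z^2) m].  Taking the modulus of the first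
relation yields [u^2 = (x/2r)^2 Phi(s2)] and [v^2 = -(x/2r)^2 Phi(s1)], so that
[phi_1 = 2 r v / x], [phi_2 = - 2 r u / x], [S_1 = r alpha_3 / x] and
[S_2 = r beta_3 / x] are admissible radicals given by rational functions of the
phase point, without degenerate cases.  The geometric integrals in the form
[x1 y2 = r^2 - z1^2] eliminate [y1, y2], which leaves rational identities; the
separated equations follow from [dx/dt = - Im (W z1)]. *)

(** * Differentiability of a continuous square root *)

(** Continuity fixes the sign of [x] near [t], so there [x] is a constant sign times [sqrt (N s)],
    and [sqrt] is differentiable at [N t > 0]. This supplies the derivative of the chosen root,
    which is only assumed continuous. *)
Lemma is_derive_square_root_branch (x N : R -> R) (t d : R) :
  continuous x t -> x t <> 0 -> locally t (fun s => x s ^ 2 = N s) ->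
  is_derive N t d -> is_derive x t (d / (2 * x t)).
Proof.
intros cx xt0 xN dN.
assert (Nt : N t = x t ^ 2) by (symmetry; exact (locally_singleton _ _ xN)).
assert (xt2 : 0 < x t ^ 2) by (apply pow2_gt_0; exact xt0).
assert (sq : sqrt (N t) = Rabs (x t)).
{ rewrite Nt, <- Rsqr_pow2; apply sqrt_Rsqr_abs. }
assert (ax : Rabs (x t) <> 0) by (apply Rabs_no_R0; exact xt0).
assert (same_sign : locally t (fun s => 0 < x s * x t)).
{ assert (c : continuous (fun s => x s * x t) t).
  { apply (continuous_mult (K := R_AbsRing)); [exact cx | apply continuous_const]. }
  apply (c (fun y => 0 < y)), (open_gt 0); nra. }
apply is_derive_ext_loc with (fun s => x t / Rabs (x t) * sqrt (N s)).
- generalize (filter_and _ _ same_sign xN); apply filter_imp.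
  intros s [Hs HN].
  match goal with |- ?u = ?v => change (@eq R u v) end.
  rewrite <- HN, <- Rsqr_pow2, sqrt_Rsqr_abs.
  destruct (Rdichotomy _ _ xt0) as [h|h].
  + rewrite !Rabs_left by nra; field; lra.
  + rewrite !Rabs_right by nra; field; lra.
- evar_last.
  + apply is_derive_scal, is_derive_comp.
    * apply is_derive_Reals, derivable_pt_lim_sqrt; rewrite Nt; exact xt2.
    * exact dN.
  + unfold scal; simpl; unfold mult; simpl; rewrite sq.
    assert (Rabs (x t) * Rabs (x t) = x t * x t) by (rewrite <- Rabs_mult; apply Rabs_right; nra).
    replace (x t / Rabs (x t) * (d * / (2 * Rabs (x t))))
      with (x t * d / (2 * (Rabs (x t) * Rabs (x t)))) by (field; exact ax).
    rewrite H; field; exact xt0.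
Qed.

(** * Real form of the equations of the second critical subsystem *)

(** The third and fourth equations are the real and imaginary parts of
[x2 w1^2 + x^2 = r^2 m x1], that is, the second equation of [M_2] together
with [M = m]. *)
Definition M2_real (r m l x : R) (p : state) : Prop :=
  let X := v1 (alpha p) - v2 (beta p) in
  let Y := v2 (alpha p) + v1 (beta p) in
  let o1 := v1 (omega p) in let o2 := v2 (omega p) in
  let g := v3 (alpha p) in let h := v3 (beta p) in
  x ^ 2 = X ^ 2 + Y ^ 2 /\
  x ^ 2 * v3 (omega p)
    = 2 * (X * (g * o1 - h * o2) + Y * (g * o2 + h * o1)) /\
  X * (o1 ^ 2 - o2 ^ 2) + 2 * Y * o1 * o2 + x ^ 2 = r ^ 2 * m * X /\
  2 * X * o1 * o2 - Y * (o1 ^ 2 - o2 ^ 2) = r ^ 2 * m * Y /\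
  o1 ^ 2 + o2 ^ 2 + (x ^ 2 + (g ^ 2 + h ^ 2)) * m = l * x.

Lemma C_eq (u v : C) : Re u = Re v -> Im u = Im v -> u = v.
Proof. destruct u, v; simpl; congruence. Qed.

Lemma x1_x2 (p : state) : (x1 p * x2 p)%C =
  RtoC ((v1 (alpha p) - v2 (beta p)) ^ 2 + (v2 (alpha p) + v1 (beta p)) ^ 2).
Proof. apply C_eq; simpl; ring. Qed.

Lemma z1_z2 (p : state) :
  (z1 p * z2 p)%C = RtoC (v3 (alpha p) ^ 2 + v3 (beta p) ^ 2).
Proof. apply C_eq; simpl; ring. Qed.

Lemma w1_w2 (p : state) :
  (w1 p * w2 p)%C = RtoC (v1 (omega p) ^ 2 + v2 (omega p) ^ 2).
Proof. apply C_eq; simpl; ring. Qed.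

Lemma RtoC_neq0 (x : R) : x <> 0 -> RtoC x <> RtoC 0.
Proof. intros h e; apply h, RtoC_inj, e. Qed.

(** The two terms of M have sum 2 r^2 m and difference 0, so each equals r^2 m; clearing the
    denominator leaves one complex equation and its conjugate. The first equation of M_2 has a
    self-conjugate left side, so only its real part carries information. *)
Lemma M2_realP (a b r m l x : R) (p : state) : r <> 0 -> x <> 0 ->
  in_phase_space a b p ->
  (in_M2 a b p /\ is_root_x x p /\ M_int r p = RtoC m /\ L_int r x p = RtoC l)
  <-> M2_real r m l x p.
Proof.
intros r0 x0 hp.
assert (cr0 := RtoC_neq0 r r0). assert (cx0 := RtoC_neq0 x x0).
assert (c20 : RtoC 2 <> RtoC 0) by (apply RtoC_neq0; lra).
assert (nz : forall u v : C, (u * v)%C <> RtoC 0 -> u <> RtoC 0 /\ v <> RtoC 0).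
{ intros u v h; split; intros e; apply h; rewrite e; ring. }
split.
- intros [[_ [x12 [e1 e2]]] [[_ hx] [hM hL]]].
  destruct (nz _ _ x12) as [x10 x20].
  assert (A : (x2 p * (w1 p ^ 2 + x1 p) = RtoC r ^ 2 * RtoC m * x1 p)%C).
  { rewrite <- hM; unfold M_int.
    transitivity ((x2 p / x1 p * (w1 p ^ 2 + x1 p)) * x1 p)%C; [field; exact x10|].
    f_equal.
    (* Subtracting half of the vanishing difference turns the first term into the half-sum that
       defines M. *)
    transitivity ((x2 p / x1 p * (w1 p ^ 2 + x1 p)) -
       / RtoC 2 * (x2 p / x1 p * (w1 p ^ 2 + x1 p) - x1 p / x2 p * (w2 p ^ 2 + x2 p)))%C.
    - rewrite e2; ring.
    - field; auto. }
  assert (hx' : x ^ 2 = (v1 (alpha p) - v2 (beta p)) ^ 2 + (v2 (alpha p) + v1 (beta p)) ^ 2).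
  { apply RtoC_inj; rewrite <- x1_x2, <- hx, RtoC_pow; reflexivity. }
  assert (B : (w1 p * w2 p + (x1 p * x2 p + z1 p * z2 p) * RtoC m = RtoC l * RtoC x)%C).
  { rewrite <- hL, <- hM; unfold L_int; field; auto. }
  rewrite x1_x2, z1_z2, w1_w2, <- hx', <- RtoC_plus, <- !RtoC_mult, <- RtoC_plus in B.
  apply RtoC_inj in B.
  assert (A1 := f_equal Re A). assert (A2 := f_equal Im A).
  assert (E1 := f_equal Re e1).
  simpl in A1, A2, E1; unfold M2_real; cbv zeta.
  split; [exact hx'|]; rewrite !hx'; rewrite hx' in B; repeat split; lra.
- unfold M2_real; cbv zeta; intros (hx & h3 & hA1 & hA2 & hL).
  assert (Cx : (RtoC x ^ 2 = x1 p * x2 p)%C).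
  { rewrite x1_x2, <- RtoC_pow; f_equal; exact hx. }
  assert (x12 : (x1 p * x2 p)%C <> RtoC 0).
  { rewrite <- Cx, <- RtoC_pow; apply RtoC_neq0, pow_nonzero, x0. }
  destruct (nz _ _ x12) as [x10 x20].
  assert (A : (x2 p * (w1 p ^ 2 + x1 p) = RtoC r ^ 2 * RtoC m * x1 p)%C).
  { apply C_eq; simpl; rewrite hx in *; lra. }
  assert (A' : (x1 p * (w2 p ^ 2 + x2 p) = RtoC r ^ 2 * RtoC m * x2 p)%C).
  { apply C_eq; simpl; rewrite hx in *; lra. }
  assert (D : (x2 p / x1 p * (w1 p ^ 2 + x1 p) = RtoC r ^ 2 * RtoC m)%C).
  { transitivity ((x2 p * (w1 p ^ 2 + x1 p)) / x1 p)%C; [field; auto|].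
    rewrite A; field; auto. }
  assert (D' : (x1 p / x2 p * (w2 p ^ 2 + x2 p) = RtoC r ^ 2 * RtoC m)%C).
  { transitivity ((x1 p * (w2 p ^ 2 + x2 p)) / x2 p)%C; [field; auto|].
    rewrite A'; field; auto. }
  assert (hM : M_int r p = RtoC m).
  { unfold M_int; rewrite D, D'; field; auto. }
  repeat split; try apply hp; try assumption.
  + apply C_eq; simpl; rewrite hx in *; lra.
  + rewrite D, D'; ring.
  + unfold L_int; rewrite hM, x1_x2, z1_z2, w1_w2.
    rewrite <- RtoC_plus, <- RtoC_mult, <- RtoC_plus.
    transitivity (RtoC 1 / RtoC x * RtoC (l * x))%C.
    * f_equal; f_equal; rewrite <- hL, hx; ring.
    * rewrite RtoC_mult; field; auto.
Qed.

(** * From a point of M_2 to separation variables and radicals *)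

(** Multiplying by [m] removes the coefficient [1 / m] and completes the square; the roots of [Phi]
    are (l + 1)/(2m) and (l - 1)/(2m). *)
Lemma Phi_square (m l s : R) : m <> 0 -> m * Phi m l s = (2 * m * s - l) ^ 2 - 1.
Proof. intros m0; unfold Phi, Psi; field; exact m0. Qed.

(** The integrals |alpha|^2 - |beta|^2 = r^2 and alpha.beta = 0 form one complex equation, which is
    solved as y1 = P + i Q = x1 (r^2 - z2^2) / x^2. *)
Lemma phase_space_y (a b r x : R) (p : state) :
  r ^ 2 = a ^ 2 - b ^ 2 -> in_phase_space a b p ->
  let X := v1 (alpha p) - v2 (beta p) in
  let Y := v2 (alpha p) + v1 (beta p) in
  let P := v1 (alpha p) + v2 (beta p) in
  let Q := v2 (alpha p) - v1 (beta p) in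
  let g := v3 (alpha p) in let h := v3 (beta p) in
  x <> 0 -> x ^ 2 = X ^ 2 + Y ^ 2 ->
  P = (X * (r ^ 2 - g ^ 2 + h ^ 2) - 2 * g * h * Y) / x ^ 2 /\
  Q = (Y * (r ^ 2 - g ^ 2 + h ^ 2) + 2 * g * h * X) / x ^ 2.
Proof.
intros hr (ha & hb & hab) X Y P Q g h x0 hx.
unfold dot in *; fold g h in ha, hb, hab.
(* [x1 y2 = r^2 - z1^2] *)
assert (e1 : X * P + Y * Q = r ^ 2 - g ^ 2 + h ^ 2) by (unfold X, Y, P, Q; lra).
assert (e2 : Y * P - X * Q = - (2 * g * h)) by (unfold X, Y, P, Q; lra).
split; apply Rmult_eq_reg_r with (x ^ 2); try (apply pow_nonzero; exact x0).
- transitivity (X * (r ^ 2 - g ^ 2 + h ^ 2) - 2 * g * h * Y); [|field; exact x0].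
  rewrite <- e1, hx; replace (2 * g * h) with (- (Y * P - X * Q)) by lra; ring.
- transitivity (Y * (r ^ 2 - g ^ 2 + h ^ 2) + 2 * g * h * X); [|field; exact x0].
  rewrite <- e1, hx; replace (2 * g * h) with (- (Y * P - X * Q)) by lra; ring.
Qed.

(** With U = |W|^2, the minus sign in [f2] is what the formula for omega_1 requires: l - 2 m s1 = (U
    - r^2 m)/x, whereas w1 = x1 W / x gives o1 = (r^2 m - U) u / x. *)
Lemma separation_of_M2_real (a b r m l x : R) (p : state) :
  0 < r -> r ^ 2 = a ^ 2 - b ^ 2 -> m <> 0 -> x <> 0 ->
  in_phase_space a b p -> M2_real r m l x p ->
  let X := v1 (alpha p) - v2 (beta p) in
  let Y := v2 (alpha p) + v1 (beta p) in
  let o1 := v1 (omega p) in let o2 := v2 (omega p) in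
  let g := v3 (alpha p) in let h := v3 (beta p) in
  let s1 := (x ^ 2 + (g ^ 2 + h ^ 2) + r ^ 2) / (2 * x) in
  let s2 := (x ^ 2 + (g ^ 2 + h ^ 2) - r ^ 2) / (2 * x) in
  let S1 := r * g / x in let S2 := r * h / x in
  let f1 := 2 * r * (X * o2 - Y * o1) / x ^ 2 in
  let f2 := - (2 * r * (X * o1 + Y * o2) / x ^ 2) in
  s1 <> s2 /\ radicals a b m l s1 s2 S1 S2 f1 f2 /\
  p = separated_state a b r m l s1 s2 S1 S2 f1 f2.
Proof.
intros r0 hr m0 x0 hp hM X Y o1 o2 g h s1 s2 S1 S2 f1 f2.
assert (r1 : r <> 0) by lra.
destruct hM as (hx & h3 & hA1 & hA2 & hL).
fold X Y g h o1 o2 in hx, h3, hA1, hA2, hL.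
destruct (phase_space_y a b r x p hr hp x0 hx) as [hP hQ].
fold X Y g h in hP, hQ.
set (P := v1 (alpha p) + v2 (beta p)) in hP.
set (Q := v2 (alpha p) - v1 (beta p)) in hQ.
destruct hp as (ha & hb & hab); unfold dot in ha, hb, hab; fold g h in ha, hb, hab.
assert (x20 : x ^ 2 <> 0) by (apply pow_nonzero; exact x0).
set (u := (X * o1 + Y * o2) / x). set (v := (X * o2 - Y * o1) / x).
assert (ef1 : f1 = 2 * r * v / x) by (unfold f1, v; field; exact x0).
assert (ef2 : f2 = - (2 * r * u / x)) by (unfold f2, u; field; exact x0).
(* Inversion of the definition of W: w1 = x1 W / x. *)
assert (eo1 : o1 = (u * X - v * Y) / x).
{ transitivity (o1 * (X ^ 2 + Y ^ 2) / x ^ 2).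
  - rewrite <- hx; field; exact x0.
  - unfold u, v; field; exact x0. }
assert (eo2 : o2 = (u * Y + v * X) / x).
{ transitivity (o2 * (X ^ 2 + Y ^ 2) / x ^ 2).
  - rewrite <- hx; field; exact x0.
  - unfold u, v; field; exact x0. }
(* Real part of W^2 = r^2 m - x2, obtained from x2 w1^2 + x^2 = r^2 m x1 by multiplying by x2 / x^2;
   [eY] is the imaginary part. *)
assert (eX : u ^ 2 - v ^ 2 = r ^ 2 * m - X).
{ transitivity ((X * (X * (o1 ^ 2 - o2 ^ 2) + 2 * Y * o1 * o2)
     + Y * (2 * X * o1 * o2 - Y * (o1 ^ 2 - o2 ^ 2))) / x ^ 2).
  - unfold u, v; field; exact x0.
  - rewrite hA2; replace (X * (o1 ^ 2 - o2 ^ 2) + 2 * Y * o1 * o2)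
      with (r ^ 2 * m * X - x ^ 2) by lra.
    transitivity ((r ^ 2 * m * (X ^ 2 + Y ^ 2) - X * x ^ 2) / x ^ 2);
      [field; exact x0 | rewrite <- hx; field; exact x0]. }
assert (eY : Y = 2 * u * v).
{ symmetry; transitivity ((X * (2 * X * o1 * o2 - Y * (o1 ^ 2 - o2 ^ 2))
     - Y * (X * (o1 ^ 2 - o2 ^ 2) + 2 * Y * o1 * o2)) / x ^ 2).
  - unfold u, v; field; exact x0.
  - rewrite hA2; replace (X * (o1 ^ 2 - o2 ^ 2) + 2 * Y * o1 * o2)
      with (r ^ 2 * m * X - x ^ 2) by lra.
    field; exact x0. }
set (U := u ^ 2 + v ^ 2).
assert (eU : U = l * x - (x ^ 2 + (g ^ 2 + h ^ 2)) * m).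
{ transitivity ((o1 ^ 2 + o2 ^ 2) * (X ^ 2 + Y ^ 2) / x ^ 2).
  - unfold U, u, v; field; exact x0.
  - rewrite <- hx; transitivity (o1 ^ 2 + o2 ^ 2); [field; exact x0 | lra]. }
(* Squared modulus of the same relation: U^2 = |r^2 m - x2|^2, which is linear in X once |x2|^2 =
   x^2. *)
assert (e2X : 2 * r ^ 2 * m * X = x ^ 2 + r ^ 4 * m ^ 2 - U ^ 2).
{ rewrite hx, eY; replace (U ^ 2) with ((u ^ 2 - v ^ 2) ^ 2 + (2 * u * v) ^ 2)
    by (unfold U; ring); rewrite eX; ring. }
assert (el : l = (U + (x ^ 2 + (g ^ 2 + h ^ 2)) * m) / x) by (rewrite eU; field; exact x0).
assert (ed : s1 - s2 = r ^ 2 / x) by (unfold s1, s2; field; exact x0).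
assert (r20 : r ^ 2 <> 0) by (apply pow_nonzero; exact r1).
assert (d0 : s1 - s2 <> 0).
{ rewrite ed; apply Rmult_integral_contrapositive_currified;
    [exact r20 | apply Rinv_neq_0_compat; exact x0]. }
assert (eL1 : l - 2 * m * s1 = (U - r ^ 2 * m) / x) by (rewrite el; unfold s1; field; exact x0).
assert (eL2 : l - 2 * m * s2 = (U + r ^ 2 * m) / x) by (rewrite el; unfold s2; field; exact x0).
(* Writing a^2 and b^2 as half-sums leaves only a^2 + b^2 to substitute; it comes from |alpha|^2 +
   |beta|^2 with |y1|^2 = |r^2 - z1^2|^2 / x^2. *)
assert (eSS : s1 ^ 2 - (a ^ 2 + b ^ 2 + r ^ 2) / 2 = S1 ^ 2 /\
              (a ^ 2 + b ^ 2 - r ^ 2) / 2 - s2 ^ 2 = S2 ^ 2 /\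
              s1 * s2 - (a ^ 2 + b ^ 2) / 2
                = - (r ^ 2 / 2) * ((r ^ 2 - g ^ 2 + h ^ 2) / x ^ 2)).
{ set (k := r ^ 2 - g ^ 2 + h ^ 2) in *.
  assert (e : a ^ 2 + b ^ 2 = (x ^ 2 + P ^ 2 + Q ^ 2) / 2 + g ^ 2 + h ^ 2)
    by (rewrite hx, <- ha, <- hb; unfold X, Y, P, Q; field).
  assert (ePQ : P ^ 2 + Q ^ 2 = (k ^ 2 + (2 * g * h) ^ 2) / x ^ 2).
  { transitivity ((X ^ 2 + Y ^ 2) * (k ^ 2 + (2 * g * h) ^ 2) / x ^ 4).
    - rewrite hP, hQ; field; exact x0.
    - rewrite <- hx; field; exact x0. }
  assert (e' : a ^ 2 + b ^ 2 = (x ^ 2 + (k ^ 2 + (2 * g * h) ^ 2) / x ^ 2) / 2 + g ^ 2 + h ^ 2)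
    by (rewrite <- ePQ; lra).
  rewrite e'; unfold s1, s2, S1, S2, k.
  repeat split; field; exact x0. }
destruct eSS as (eS1 & eS2 & es12).
assert (hrad : radicals a b m l s1 s2 S1 S2 f1 f2).
{ repeat split.
  - lra.
  - lra.
  - apply Rmult_eq_reg_l with m; [|exact m0].
    transitivity (- (m * Phi m l s1)); [|ring].
    rewrite (Phi_square _ _ _ m0).
    replace (2 * m * s1 - l) with (- ((U - r ^ 2 * m) / x)) by lra.
    (* By [e2X] the numerator is x^2 - (U - r^2 m)^2; since X + U - r^2 m = 2 v^2, it also equals 4
       r^2 m v^2. For [f2] the analogue is - X + U + r^2 m = 2 u^2. *)
    transitivity ((2 * r ^ 2 * m * X + 2 * r ^ 2 * m * (U - r ^ 2 * m)) / x ^ 2).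
    + replace X with (r ^ 2 * m - (u ^ 2 - v ^ 2)) by lra.
      rewrite ef1; unfold U; field; exact x0.
    + rewrite e2X; field; exact x0.
  - apply Rmult_eq_reg_l with m; [|exact m0].
    rewrite (Phi_square _ _ _ m0).
    replace (2 * m * s2 - l) with (- ((U + r ^ 2 * m) / x)) by lra.
    transitivity ((- (2 * r ^ 2 * m * X) + 2 * r ^ 2 * m * (U + r ^ 2 * m)) / x ^ 2).
    + replace X with (r ^ 2 * m - (u ^ 2 - v ^ 2)) by lra.
      rewrite ef2; unfold U; field; exact x0.
    + rewrite e2X; field; exact x0. }
split; [lra|]; split; [exact hrad|].
(* Polarized form of [Phi_square]: m Psi = (2 m s1 - l)(2 m s2 - l) - 1 = (U^2 - r^4 m^2)/x^2 -
   1. *)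
assert (ePsi : Psi m l s1 s2 = - (2 * r ^ 2 * X / x ^ 2)).
{ apply Rmult_eq_reg_l with m; [|exact m0].
  transitivity (- ((2 * r ^ 2 * m * X) / x ^ 2)); [|field; exact x0].
  rewrite e2X, el; unfold Psi, s1, s2; field; auto. }
assert (eff : f1 * f2 = - (2 * r ^ 2 * Y / x ^ 2)).
{ rewrite ef1, ef2, eY; field; exact x0. }
assert (eSp : S1 * S2 = r ^ 2 * (g * h) / x ^ 2) by (unfold S1, S2; field; exact x0).
assert (esa : s1 * s2 - a ^ 2 = - (r ^ 2 / 2) * (1 + (r ^ 2 - g ^ 2 + h ^ 2) / x ^ 2)) by lra.
assert (esb : s1 * s2 - b ^ 2 = (r ^ 2 / 2) * (1 - (r ^ 2 - g ^ 2 + h ^ 2) / x ^ 2)) by lra.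
(* The first equation of M_2 reads x^2 w3 = 2 Re (x2 z1 w1), and x2 w1 = x W. *)
assert (ew3 : v3 (omega p) = 2 * (g * u - h * v) / x).
{ apply Rmult_eq_reg_l with (x ^ 2); [|exact x20].
  rewrite h3; unfold u, v; field; exact x0. }
assert (al1 : v1 (alpha p) = (X + P) / 2) by (unfold X, P; field).
assert (al2 : v2 (alpha p) = (Y + Q) / 2) by (unfold Y, Q; field).
assert (be1 : v1 (beta p) = (Y - Q) / 2) by (unfold Y, Q; field).
assert (be2 : v2 (beta p) = (P - X) / 2) by (unfold X, P; field).
destruct p as [[p1 p2 p3] [q1 q2 q3] [t1 t2 t3]].
unfold separated_state; simpl v1 in *; simpl v2 in *; simpl v3 in *.
rewrite ePsi, eL1, eL2, ed.
clearbody X Y P Q u v.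
replace ((s1 * s2 - a ^ 2) * (- (2 * r ^ 2 * X / x ^ 2)) + S1 * S2 * f1 * f2)
  with ((s1 * s2 - a ^ 2) * (- (2 * r ^ 2 * X / x ^ 2)) + (S1 * S2) * (f1 * f2)) by ring.
replace ((s1 * s2 - b ^ 2) * (- (2 * r ^ 2 * X / x ^ 2)) + S1 * S2 * f1 * f2)
  with ((s1 * s2 - b ^ 2) * (- (2 * r ^ 2 * X / x ^ 2)) + (S1 * S2) * (f1 * f2)) by ring.
rewrite !Rmult_assoc with (r2 := f1), eff, eSp, esa, esb.
f_equal; f_equal.
- change p1 with o1; rewrite eo1, ef2, eY; replace X with (r ^ 2 * m - (u ^ 2 - v ^ 2)) by lra.
  unfold U; field; auto.
- change p2 with o2; rewrite eo2, ef1, eY; replace X with (r ^ 2 * m - (u ^ 2 - v ^ 2)) by lra.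
  unfold U; field; auto.
- rewrite ew3, ef1, ef2; unfold S1, S2; field; auto.
- rewrite al1, hP; field; auto.
- rewrite al2, hQ; field; auto.
- unfold S1; change q3 with g; field; auto.
- rewrite be1, hQ; field; auto.
- rewrite be2, hP; field; auto.
- unfold S2; change t3 with h; field; auto.
Qed.

(** * From radicals of arbitrary sign to a point of M_2 *)

(** The key identity is Psi^2 - Phi(s1) Phi(s2) = 4 (s1 - s2)^2. The intermediate expressions group
    each condition so that, apart from monomial factors, the radicals occur squared; hence any signs
    are allowed. *)
Lemma M2_real_separated_state (a b r m l s1 s2 S1 S2 f1 f2 : R) :
  0 < r -> r ^ 2 = a ^ 2 - b ^ 2 -> m <> 0 -> s1 <> s2 ->
  radicals a b m l s1 s2 S1 S2 f1 f2 ->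
  let p := separated_state a b r m l s1 s2 S1 S2 f1 f2 in
  in_phase_space a b p /\ M2_real r m l (r ^ 2 / (s1 - s2)) p.
Proof.
intros r0 hr m0 s12 (hS1 & hS2 & hf1 & hf2) p.
assert (d0 : s1 - s2 <> 0) by lra.
assert (hPsi : Psi m l s1 s2 ^ 2 + f1 ^ 2 * f2 ^ 2 = 4 * (s1 - s2) ^ 2).
{ rewrite hf1, hf2; unfold Phi, Psi; field; exact m0. }
assert (eS : S1 ^ 2 + S2 ^ 2 + r ^ 2 = s1 ^ 2 - s2 ^ 2) by lra.
split.
- unfold in_phase_space, dot, p; simpl v1; simpl v2; simpl v3.
  repeat split.
  (* Two-square identity (A Psi + S f)^2 + (A f - S Psi)^2 = (A^2 + S^2)(Psi^2 + f^2) with A = s1 s2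
     - a^2, S = S1 S2, f = f1 f2. *)
  + transitivity (((s1 * s2 - a ^ 2) ^ 2 + S1 ^ 2 * S2 ^ 2)
      * (Psi m l s1 s2 ^ 2 + f1 ^ 2 * f2 ^ 2) / (4 * (s1 - s2) ^ 4)
      + r ^ 2 * S1 ^ 2 / (s1 - s2) ^ 2); [field; exact d0|].
    rewrite hPsi, hS1, hS2, hr; field; exact d0.
  + transitivity (((s1 * s2 - b ^ 2) ^ 2 + S1 ^ 2 * S2 ^ 2)
      * (Psi m l s1 s2 ^ 2 + f1 ^ 2 * f2 ^ 2) / (4 * (s1 - s2) ^ 4)
      + r ^ 2 * S2 ^ 2 / (s1 - s2) ^ 2); [field; exact d0|].
    rewrite hPsi, hS1, hS2, hr; field; exact d0.
  + transitivity (S1 * S2 * (b ^ 2 - a ^ 2)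
      * (Psi m l s1 s2 ^ 2 + f1 ^ 2 * f2 ^ 2) / (4 * (s1 - s2) ^ 4)
      + r ^ 2 * S1 * S2 / (s1 - s2) ^ 2); [field; exact d0|].
    rewrite hPsi, hr; field; exact d0.
(* The terms in S1 S2 cancel between alpha and beta, leaving x1 = - r^2 (Psi + i f1 f2) / (2 (s1 -
   s2)^2). *)
- assert (eX : v1 (alpha p) - v2 (beta p) = - (r ^ 2 * Psi m l s1 s2 / (2 * (s1 - s2) ^ 2)))
    by (unfold p; simpl v1; simpl v2; rewrite hr; field; exact d0).
  assert (eY : v2 (alpha p) + v1 (beta p) = - (r ^ 2 * (f1 * f2) / (2 * (s1 - s2) ^ 2)))
    by (unfold p; simpl v1; simpl v2; rewrite hr; field; exact d0).
  unfold M2_real; cbv zeta; rewrite eX, eY; unfold p; simpl v1; simpl v2; simpl v3.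
  repeat split.
  + transitivity (r ^ 4 * (4 * (s1 - s2) ^ 2) / (4 * (s1 - s2) ^ 4)); [field; exact d0|].
    rewrite <- hPsi; field; exact d0.
  (* Grouped by the monomials [S1 * f2] and [S2 * f1]; both remaining factors equal 2 (s1 - s2). *)
  + transitivity (- (r ^ 4 / (2 * (s1 - s2) ^ 4) *
      (S1 * f2 * (Psi m l s1 s2 * (l - 2 * m * s1) + f1 ^ 2 * (l - 2 * m * s2))
       + S2 * f1 * (f2 ^ 2 * (l - 2 * m * s1) - Psi m l s1 s2 * (l - 2 * m * s2)))));
      [|field; exact d0].
    rewrite hf1, hf2; unfold Phi, Psi; field; auto.
  + transitivity (- (r ^ 4 / (8 * (s1 - s2) ^ 4)) *
      (Psi m l s1 s2 * ((l - 2 * m * s1) ^ 2 * f2 ^ 2 - (l - 2 * m * s2) ^ 2 * f1 ^ 2)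
       + 2 * f1 ^ 2 * f2 ^ 2 * (l - 2 * m * s1) * (l - 2 * m * s2))
      + r ^ 4 / (s1 - s2) ^ 2); [field; exact d0|].
    rewrite hf1, hf2; unfold Phi, Psi; field; auto.
  + transitivity (- (r ^ 4 / (8 * (s1 - s2) ^ 4)) * (f1 * f2) *
      (2 * Psi m l s1 s2 * (l - 2 * m * s1) * (l - 2 * m * s2)
       - (l - 2 * m * s1) ^ 2 * f2 ^ 2 + (l - 2 * m * s2) ^ 2 * f1 ^ 2));
      [field; exact d0|].
    rewrite hf1, hf2; unfold Phi, Psi; field; auto.
  + transitivity (r ^ 2 / (4 * (s1 - s2) ^ 2) *
      ((l - 2 * m * s1) ^ 2 * f2 ^ 2 + (l - 2 * m * s2) ^ 2 * f1 ^ 2)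
      + m * r ^ 2 * (S1 ^ 2 + S2 ^ 2 + r ^ 2) / (s1 - s2) ^ 2); [field; exact d0|].
    rewrite eS, hf1, hf2; unfold Phi, Psi; field; auto.
Qed.

(** * Derivatives of the separation variables along the flow *)

(** The derivative is - 2 Im (x2 z1 w1): omega_3 enters the derivative of x1 only as - i omega_3 x1,
    a rotation that leaves |x1|^2 unchanged. *)
Lemma is_derive_x_sqr (p : R -> state) (t : R) :
  kowalevski_eqs p t ->
  let q := p t in
  let X := v1 (alpha q) - v2 (beta q) in
  let Y := v2 (alpha q) + v1 (beta q) in
  let o1 := v1 (omega q) in let o2 := v2 (omega q) in
  let g := v3 (alpha q) in let h := v3 (beta q) in
  is_derive (fun s => (v1 (alpha (p s)) - v2 (beta (p s))) ^ 2
                    + (v2 (alpha (p s)) + v1 (beta (p s))) ^ 2) t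
    (2 * (Y * (g * o1 - h * o2) - X * (g * o2 + h * o1))).
Proof.
intros (_ & _ & _ & (d1 & d2 & _) & (d4 & d5 & _)).
simpl in d1, d2, d4, d5 |- *.
evar_last.
- apply (is_derive_plus (fun s => (v1 (alpha (p s)) - v2 (beta (p s))) ^ 2)
    (fun s => (v2 (alpha (p s)) + v1 (beta (p s))) ^ 2)); apply is_derive_pow.
  + apply (is_derive_minus (fun s => v1 (alpha (p s)))); [exact d1 | exact d5].
  + apply (is_derive_plus (fun s => v2 (alpha (p s)))); [exact d2 | exact d4].
- unfold minus, plus, opp; simpl; ring.
Qed.

Lemma is_derive_z_sqr (p : R -> state) (t : R) :
  kowalevski_eqs p t ->
  let q := p t in
  is_derive (fun s => v3 (alpha (p s)) ^ 2 + v3 (beta (p s)) ^ 2) t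
    (2 * v3 (alpha q) * (v1 (alpha q) * v2 (omega q) - v2 (alpha q) * v1 (omega q))
     + 2 * v3 (beta q) * (v1 (beta q) * v2 (omega q) - v2 (beta q) * v1 (omega q))).
Proof.
intros (_ & _ & _ & (_ & _ & d3) & (_ & _ & d6)).
simpl in d3, d6 |- *.
evar_last.
- apply (is_derive_plus (fun s => v3 (alpha (p s)) ^ 2)
    (fun s => v3 (beta (p s)) ^ 2)); apply is_derive_pow; [exact d3 | exact d6].
- unfold plus; simpl; ring.
Qed.

(** The cases [c = 1] and [c = -1] are [s1] and [s2]. *)
Lemma is_derive_separation_variable (a b r c : R) (p : R -> state) (x : R -> R) (t : R) :
  r ^ 2 = a ^ 2 - b ^ 2 -> in_phase_space a b (p t) -> kowalevski_eqs p t ->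
  continuous x t -> x t <> 0 ->
  locally t (fun s => x s ^ 2 = (v1 (alpha (p s)) - v2 (beta (p s))) ^ 2
                    + (v2 (alpha (p s)) + v1 (beta (p s))) ^ 2) ->
  let X := v1 (alpha (p t)) - v2 (beta (p t)) in
  let Y := v2 (alpha (p t)) + v1 (beta (p t)) in
  let o1 := v1 (omega (p t)) in let o2 := v2 (omega (p t)) in
  let g := v3 (alpha (p t)) in let h := v3 (beta (p t)) in
  is_derive (fun s => (x s ^ 2 + (v3 (alpha (p s)) ^ 2 + v3 (beta (p s)) ^ 2) + c * r ^ 2)
                      / (2 * x s)) t
    (r ^ 2 / (2 * x t ^ 3) *
      ((1 + c) * g * (X * o2 - Y * o1) - (1 - c) * h * (X * o1 + Y * o2))).
Proof.
intros hr hp ht cx x0 hx X Y o1 o2 g h.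
assert (dN := is_derive_x_sqr p t ht).
assert (dz := is_derive_z_sqr p t ht).
assert (dx := is_derive_square_root_branch _ _ _ _ cx x0 hx dN).
cbv zeta in dN, dz, dx; fold X Y o1 o2 g h in dN, dz, dx.
assert (hxt := locally_singleton _ _ hx); cbv beta in hxt; fold X Y in hxt.
destruct (phase_space_y a b r (x t) (p t) hr hp x0 hxt) as [hP hQ].
fold X Y g h in hP, hQ.
set (P := v1 (alpha (p t)) + v2 (beta (p t))) in hP.
set (Q := v2 (alpha (p t)) - v1 (beta (p t))) in hQ.
(* Passing from alpha, beta to x1, y1 and eliminating y1 makes the derivative of z^2 rational in X,
   Y, g, h, o1, o2 and x. *)
replace (v1 (alpha (p t))) with ((X + P) / 2) in dz by (unfold X, P; field).
replace (v2 (alpha (p t))) with ((Y + Q) / 2) in dz by (unfold Y, Q; field).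
replace (v1 (beta (p t))) with ((Y - Q) / 2) in dz by (unfold Y, Q; field).
replace (v2 (beta (p t))) with ((P - X) / 2) in dz by (unfold X, P; field).
rewrite hP, hQ in dz.
evar_last.
- apply is_derive_div.
  + apply (is_derive_plus
      (fun s => x s ^ 2 + (v3 (alpha (p s)) ^ 2 + v3 (beta (p s)) ^ 2)) (fun _ => c * r ^ 2)).
    * apply (is_derive_plus (fun s => x s ^ 2)); [apply is_derive_pow; exact dx | exact dz].
    * apply is_derive_const.
  + apply (is_derive_scal x), dx.
  + lra.
- unfold plus, zero; simpl.
  fold g h.
  match goal with |- ?u = ?v => change (@eq R u v) end.
  field; exact x0.
Qed.

(** * Separated motion along a solution, and the converse construction *)

Theorem mainTheorem1 :
  forall (a b r m l : R),
  0 < b -> b < a -> 0 < r -> r ^ 2 = a ^ 2 - b ^ 2 -> m <> 0 ->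
  (forall (tmin tmax : Rbar) (p : R -> state) (x : R -> R),
    (forall t : R, Rbar_lt tmin t -> Rbar_lt t tmax ->
       kowalevski_eqs p t /\
       in_M2 a b (p t) /\
       is_root_x (x t) (p t) /\
       continuous x t /\
       M_int r (p t) = RtoC m /\
       L_int r (x t) (p t) = RtoC l) ->
    exists s1 s2 : R -> R,
    forall t : R, Rbar_lt tmin t -> Rbar_lt t tmax ->
      s1_expr r (x t) (p t) = RtoC (s1 t) /\
      s2_expr r (x t) (p t) = RtoC (s2 t) /\
      admissible a b m l (s1 t) (s2 t) /\
      exists S1 S2 f1 f2 : R,
        radicals a b m l (s1 t) (s2 t) S1 S2 f1 f2 /\
        p t = separated_state a b r m l (s1 t) (s2 t) S1 S2 f1 f2 /\
        is_derive s1 t (1 / 2 * S1 * f1) /\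
        is_derive s2 t (1 / 2 * S2 * f2)) /\
  (forall s1 s2 S1 S2 f1 f2 : R,
    admissible a b m l s1 s2 ->
    radicals a b m l s1 s2 S1 S2 f1 f2 ->
    let p := separated_state a b r m l s1 s2 S1 S2 f1 f2 in
    let x := r ^ 2 / (s1 - s2) in
    in_M2 a b p /\
    is_root_x x p /\
    M_int r p = RtoC m /\
    L_int r x p = RtoC l).
Proof.
intros a b r m l b0 ba r0 hr m0.
assert (r1 : r <> 0) by lra.
split.
- intros tmin tmax p x H.
  set (s := fun c t => (x t ^ 2 + (v3 (alpha (p t)) ^ 2 + v3 (beta (p t)) ^ 2)
                        + c * r ^ 2) / (2 * x t)).
  exists (s 1), (s (- 1)); intros t t1 t2.
  (* Differentiating [x] at [t] needs this relation in a neighbourhood of [t], hence on the whole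
     open interval. *)
  assert (Hroot : forall u : R, Rbar_lt tmin u -> Rbar_lt u tmax ->
    x u ^ 2 = (v1 (alpha (p u)) - v2 (beta (p u))) ^ 2
            + (v2 (alpha (p u)) + v1 (beta (p u))) ^ 2).
  { intros u u1 u2; destruct (H u u1 u2) as (_ & _ & [_ e] & _).
    apply RtoC_inj; rewrite <- x1_x2, <- e; apply RtoC_pow. }
  destruct (H t t1 t2) as (ht & hM2 & hx & cx & hM & hL).
  assert (x0 := proj1 hx). assert (hp := proj1 hM2).
  assert (hR := proj1 (M2_realP a b r m l (x t) (p t) r1 x0 hp)
                  (conj hM2 (conj hx (conj hM hL)))).
  assert (hloc := locally_interval _ t tmin tmax t1 t2 Hroot).
  assert (D := fun c =>
    is_derive_separation_variable a b r c p x t hr hp ht cx x0 hloc).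
  destruct (separation_of_M2_real a b r m l (x t) (p t) r0 hr m0 x0 hp hR)
    as (s12 & hrad & heq).
  set (S1 := r * v3 (alpha (p t)) / x t) in *.
  set (S2 := r * v3 (beta (p t)) / x t) in *.
  match type of hrad with
    radicals _ _ _ _ ?u ?v _ _ ?f ?g => set (f1 := f) in *; set (f2 := g) in *;
      replace u with (s 1 t) in * by (unfold s; field; exact x0);
      replace v with (s (- 1) t) in * by (unfold s; field; exact x0)
  end.
  assert (x2 : 2 * x t <> 0) by lra.
  split; [|split; [|split]].
  + unfold s1_expr, s; rewrite z1_z2, RtoC_div by exact x2.
    rewrite !RtoC_plus, !RtoC_mult, !RtoC_pow; f_equal; ring.
  + unfold s2_expr, s; replace (- 1) with (Ropp 1) by lra.
    rewrite z1_z2, RtoC_div by exact x2.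
    rewrite !RtoC_plus, !RtoC_mult, !RtoC_pow, RtoC_opp; f_equal; ring.
  (* The inequalities hold because each radicand is the square of a real number. *)
  + destruct hrad as (e1 & e2 & e3 & e4).
    assert (n1 := pow2_ge_0 S1); assert (n2 := pow2_ge_0 S2).
    assert (n3 := pow2_ge_0 f1); assert (n4 := pow2_ge_0 f2).
    unfold admissible; repeat split; try assumption; lra.
  + exists S1, S2, f1, f2; split; [exact hrad|]; split; [exact heq|]; split.
    (* For c = 1 only the term with g survives and equals S1 f1 / 2; for c = -1 only the term with
       h, equal to S2 f2 / 2. *)
    * evar_last; [apply (D 1)|]; unfold S1, f1; cbv zeta.
      match goal with |- ?u = ?v => change (@eq R u v) end; field; exact x0.
    * evar_last; [apply (D (- 1))|]; unfold S2, f2; cbv zeta.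
      match goal with |- ?u = ?v => change (@eq R u v) end; field; exact x0.
- intros s1 s2 S1 S2 f1 f2 (s12 & _) hrad p x.
  destruct (M2_real_separated_state a b r m l s1 s2 S1 S2 f1 f2 r0 hr m0 s12 hrad)
    as [hp hR].
  assert (x0 : x <> 0).
  { apply Rmult_integral_contrapositive_currified;
      [apply pow_nonzero; exact r1 | apply Rinv_neq_0_compat; lra]. }
  exact (proj2 (M2_realP a b r m l x p r1 x0 hp) hR).
Qed.
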